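(* Let $c\in\{\alpha,\beta\}$ and let $(P=\bigcup_{0\le i\le n}P_i,\,s,\,v)$ be a signed poset which is $c$-signed differential up to level $n-1$. Let $(P^+,s^+,v^+)$ be its signed reflection extension (of type $c$). Then $(P^+,s^+,v^+)$ is $c$-signed differential up to level $n$. Thus $\lim_{t\to\infty}P^{+t}$ is a $c$-signed differential poset.
   Context: $K$ is a field of characteristic $0$. All posets $P$ considered are graded, with a minimum $\hat 0\in P_0$ and finitely many elements of each rank ($P_i$ is the set of elements of rank $i$); $x\lessdot y$ means $y$ covers $x$. $\hat KP$ is the $K$-vector space of arbitrary $K$-linear combinations of elements of $P$, $\mathbf P=\sum_{x\in P}x$, $\mathbf P_i=\sum_{x\in P_i}x$. A signed poset $(P,s,v)$ consists of such a $P$ with signs $s(x\lessdot y)\in\{\pm1\}$ on cover relations and $v:P\to\{\pm1\}$. Define operators (linear, preserving infinite linear combinations) by $Ux=\sum_{y\gtrdot x}s(x\lessdot y)y$ and $Dx=\sum_{y\lessdot x}s(y\lessdot x)v(x)v(y)y$. The signed poset is weakly signed differential if $v(\hat 0)=1$ and $UD+DU=I$; it is $\alpha$-signed differential if in addition $(U+D)\mathbf P=\mathbf P$, and $\beta$-signed differential if instead in addition $(D-U)\mathbf P=\mathbf P$. A signed poset $(P,s,v)$ with $P=\bigcup_{0\le i\le n}P_i$ is $\alpha$- (resp. $\beta$-) signed differential up to level $n-1$ if $v(\hat 0)=1$, $UD+DU=I$ holds on the span of $\bigcup_{0\le i\le n-1}P_i$, and $(U+D)\mathbf P$ (resp. $(D-U)\mathbf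 P$) is equal to $\sum_{0\le i\le n-1}\mathbf P_i$ modulo $KP_n$, where $KP_n$ is the span of $P_n$. Signed reflection extension: for $(P=\bigcup_{0\le i\le n}P_i,s,v)$ define $P^+=\bigcup_{0\le i\le n+1}P^+_i$ with $P_i^+=P_i$ for $0\le i\le n$ (with the same covers among these elements, and $s^+|_P=s$, $v^+|_P=v$). $P^+_{n+1}$ consists of one new element $x^+$ for each $x\in P_{n-1}$ and one new element $y^*$ for each $y\in P_n$ (with $P_{-1}=\emptyset$). The new cover relations are $y\lessdot y^*$ for each $y\in P_n$, and $y\lessdot x^+$ for each $x\in P_{n-1}$, $y\in P_n$ with $x\lessdot y$. Set $v^+(y^* )=v(y)$, $v^+(x^+)=-v(x)$, $s^+(y\lessdot y^* )=1$, and $$s^+(y\lessdot x^+)=\begin{cases}-v^+(x^+)\,v^+(y)\,s(x\lessdot y)&\text{in the }\alpha\text{ case},\\ \ \ v^+(x^+)\,v^+(y)\,s(x\lessdot y)&\text{in the }\beta\text{ case}.\end{cases}$$ Inductively $P^{+t}=(P^{+(t-1)})^+$ with $P^{+0}=P$; since $P^{+(t-1)}$ is the part of $P^{+t}$ of rank at most $n+t-1$, the limit $\lim_{t\to\infty}P^{+t}$ is the increasing union of these signed posets.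
   Formalization: If some element of rank n−1 has no cover, the extension and the limit have no minimum (α: P={0<a}, all signs 1, n=2, P_2 empty); so all else is proved unconditionally, and that a minimum exists exactly when every element of P_{n-1} is covered. *)

(* Defs.v *)
From HB Require Import structures.
From mathcomp Require Import all_boot all_order all_algebra.
From mathcomp Require Import boolp classical_sets functions cardinality fsbigop.

Set Implicit Arguments.
Unset Strict Implicit.
Unset Printing Implicit Defensive.

Import Order.TTheory GRing.Theory Num.Theory.
Local Open Scope classical_set_scope.
Local Open Scope order_scope.
Local Open Scope ring_scope.

(* Signs are the integers 1 and -1; [sgn x y] is meaningful only when y covers
   x.  The axioms (grading, finiteness, minimum, values of the signs) are stated
   separately below. *)
Record sposet (d : Order.disp_t) := SPoset {
  carrier :> porderType d ;
  rk : carrier -> nat ;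
  bot : carrier ;
  sgn : carrier -> carrier -> int ;
  vsgn : carrier -> int ;
  rk_bot : rk bot = 0%N }.

Arguments rk {d} {s} x.
Arguments bot {d} s.
Arguments sgn {d} {s} x y.
Arguments vsgn {d} {s} x.

Definition covers (d : Order.disp_t) (T : porderType d) (x y : T) : Prop :=
  (x < y)%O /\ forall z : T, ~ (x < z < y)%O.

Definition is_sign (z : int) : Prop := z = 1 \/ z = -1.

Record graded_signed (d : Order.disp_t) (P : sposet d) : Prop := GradedSigned {
  graded_lt : forall x y : P, (x < y)%O -> (rk x < rk y)%N ;
  graded_covers : forall x y : P, covers x y -> rk y = (rk x).+1 ;
  graded_finite : forall i : nat, finite_set [set x : P | rk x = i] ;
  sgn_sign : forall x y : P, covers x y -> is_sign (sgn x y) ;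
  vsgn_sign : forall x : P, is_sign (vsgn x) }.

Definition has_minimum (d : Order.disp_t) (P : sposet d) : Prop :=
  forall x : P, (bot P <= x)%O.

Section Operators.
Variables (K : fieldType) (d : Order.disp_t) (P : sposet d).

(* An arbitrary linear combination of elements of P is its coefficient function
   P -> K.  Applying U x = \sum_(y covers x) s(x,y) y to \sum_x f(x) x and
   collecting the coefficient of y gives the first formula, and similarly for
   the second one.  When P is graded_signed these sums have finite support. *)
Definition opU (f : P -> K) : P -> K := fun y =>
  \sum_(x \in [set x : P | covers x y]) (sgn x y)%:~R * f x.

Definition opD (f : P -> K) : P -> K := fun y =>
  \sum_(x \in [set x : P | covers y x])
    (sgn y x * vsgn x * vsgn y)%:~R * f x.

Definition all_sum : P -> K := fun=> 1.

Definition rank_sum (i : nat) : P -> K := fun x => (rk x == i)%:R.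

Definition span_rank (n : nat) : set (P -> K) :=
  [set f | forall x, rk x <> n -> f x = 0].

Definition span_below (n : nat) : set (P -> K) :=
  [set f | forall x, (n <= rk x)%N -> f x = 0].

End Operators.

Arguments all_sum K {d} P.
Arguments rank_sum K {d} P i.

Inductive sd_type := alpha | beta.

Definition sd_op (K : fieldType) (d : Order.disp_t) (P : sposet d)
    (c : sd_type) (f : P -> K) : P -> K :=
  match c with
  | alpha => opU f + opD f
  | beta => opD f - opU f
  end.

(* In the next two definitions the requirement that [bot P] be the minimum of P
   is left to [has_minimum]. *)
Definition signed_differential (K : fieldType) (d : Order.disp_t)
    (c : sd_type) (P : sposet d) : Prop :=
  [/\ graded_signed P,
      vsgn (bot P) = 1,
      forall f : P -> K, opU (opD f) + opD (opU f) = f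
    & sd_op c (all_sum K P) = all_sum K P].

(* P is the union of its ranks 0, ..., n, and is c-signed differential up to
   level n - 1; this makes sense for n = 0 too. *)
Definition signed_differential_upto (K : fieldType) (d : Order.disp_t)
    (c : sd_type) (n : nat) (P : sposet d) : Prop :=
  [/\ graded_signed P,
      forall x : P, (rk x <= n)%N,
      vsgn (bot P) = 1,
      forall f : P -> K, span_below n f -> opU (opD f) + opD (opU f) = f
    & span_rank n (sd_op c (all_sum K P) - \sum_(i < n) rank_sum K P i)].

Section ReflectionExtension.
Variables (d : Order.disp_t) (c : sd_type) (n : nat) (P : sposet d).

(* [star y] is y^* and [plus x] is x^+ *)
Inductive ext_carrier : Type :=
| old (x : P)
| star (y : P) of rk y = n
| plus (x : P) of (rk x).+1 = n.

HB.instance Definition _ := gen_eqMixin ext_carrier.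
HB.instance Definition _ := gen_choiceMixin ext_carrier.

(* The order generated by the covers of P and the new covers y < y^* and
   y < x^+, for y in P_n and x in P_(n-1) covered by y. *)
Definition ext_le (a b : ext_carrier) : bool :=
  match a, b with
  | old x, old y => (x <= y)%O
  | old x, @star y _ => (x <= y)%O
  | old z, @plus x _ => `[< exists y : P, [/\ rk y = n, covers x y & (z <= y)%O] >]
  | @star x _, @star y _ => x == y
  | @plus x _, @plus y _ => x == y
  | _, _ => false
  end.

Lemma ext_le_refl : reflexive ext_le.
Proof. by case=> [x|x ?|x ?] /=. Qed.

Lemma ext_le_anti : antisymmetric ext_le.
Proof.
case=> [x|x rx|x rx] [y|y ry|y ry] //= /andP[] //.
- by move=> xy yx; congr old; apply/le_anti/andP.
- by move=> /eqP xy _; subst y; congr star; exact: eq_irrelevance.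
- by move=> /eqP xy _; subst y; congr plus; exact: eq_irrelevance.
Qed.

Lemma ext_le_trans : transitive ext_le.
Proof.
case=> [y|y ry|y ry] [x|x rx|x rx] [z|z rz|z rz] //=.
- exact: le_trans.
- exact: le_trans.
- move=> xy /asboolP[t [rt zt yt]]; apply/asboolP; exists t; split=> //.
  exact: le_trans yt.
- by move=> xy /eqP <-.
- by move=> /eqP ->.
- by move=> xy /eqP <-.
- by move=> /eqP ->.
Qed.

HB.instance Definition _ := Order.Le_isPOrder.Build d ext_carrier
  ext_le_refl ext_le_anti ext_le_trans.

Definition ext_rk (a : ext_carrier) : nat :=
  match a with
  | old x => rk x
  | star _ _ | plus _ _ => n.+1
  end.

Definition ext_vsgn (a : ext_carrier) : int :=
  match a with
  | old x => vsgn x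
  | @star y _ => vsgn y
  | @plus x _ => - vsgn x
  end.

Definition type_sign : int := match c with alpha => -1 | beta => 1 end.

Definition ext_sgn (a b : ext_carrier) : int :=
  match a, b with
  | old x, old y => sgn x y
  | old y, @plus x _ => type_sign * (ext_vsgn b * vsgn y * sgn x y)
  | _, _ => 1
  end.

Definition refl_ext : sposet d :=
  @SPoset d ext_carrier ext_rk (old (bot P)) ext_sgn ext_vsgn (rk_bot P).

End ReflectionExtension.

Section Limit.
Variables (d : Order.disp_t) (c : sd_type) (n : nat) (P : sposet d).

Fixpoint iter_ext (t : nat) : sposet d :=
  match t with
  | 0%N => P
  | t'.+1 => refl_ext c (n + t') (iter_ext t')
  end.

Fixpoint embed (k t : nat) (x : iter_ext t) : iter_ext (k + t) :=
  match k with
  | 0%N => x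
  | k'.+1 => old (n + (k' + t)) (embed k' x)
  end.

Definition cast_ext (t u : nat) (e : t = u) (x : iter_ext t) : iter_ext u :=
  ecast i (iter_ext i) e x.

Definition lift_ext (t u : nat) (tu : (t <= u)%N) (x : iter_ext t) :
    iter_ext u := cast_ext (subnK tu) (embed (u - t) x).

(* The increasing union of the P^(+t).  As P^(+i) is the part of rank at most
   n + i, the elements of rank i of the union are those of P^(+i), and this is
   how they are represented; elements of different ranks are compared in a
   common P^(+m). *)
Record lim_carrier : Type := Lim {
  lim_rk : nat ;
  lim_elt : iter_ext lim_rk ;
  lim_eltP : rk lim_elt = lim_rk }.

HB.instance Definition _ := gen_eqMixin lim_carrier.
HB.instance Definition _ := gen_choiceMixin lim_carrier.

Definition lim_le (a b : lim_carrier) : bool :=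
  (lift_ext (leq_maxl (lim_rk a) (lim_rk b)) (lim_elt a)
   <= lift_ext (leq_maxr (lim_rk a) (lim_rk b)) (lim_elt b))%O.

Definition lim_sgn (a b : lim_carrier) : int :=
  sgn (lift_ext (leq_maxl (lim_rk a) (lim_rk b)) (lim_elt a))
      (lift_ext (leq_maxr (lim_rk a) (lim_rk b)) (lim_elt b)).

Definition lim_vsgn (a : lim_carrier) : int := vsgn (lim_elt a).

Definition lim_bot : lim_carrier := @Lim 0 (bot P) (rk_bot P).

Lemma le_embed k t (x y : iter_ext t) :
  (embed k x <= embed k y)%O = (x <= y)%O.
Proof. by elim: k => //= k <-. Qed.

Lemma rk_embed k t (x : iter_ext t) : rk (embed k x) = rk x.
Proof. by elim: k => //= k <-. Qed.

Lemma le_cast t u (e : t = u) (x y : iter_ext t) :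
  (cast_ext e x <= cast_ext e y)%O = (x <= y)%O.
Proof. by case: u / e. Qed.

Lemma rk_cast t u (e : t = u) (x : iter_ext t) : rk (cast_ext e x) = rk x.
Proof. by case: u / e. Qed.

Lemma le_lift t u (tu : (t <= u)%N) (x y : iter_ext t) :
  (lift_ext tu x <= lift_ext tu y)%O = (x <= y)%O.
Proof. by rewrite le_cast le_embed. Qed.

Lemma rk_lift t u (tu : (t <= u)%N) (x : iter_ext t) : rk (lift_ext tu x) = rk x.
Proof. by rewrite rk_cast rk_embed. Qed.

Lemma lift_embed k t u (tu : (t <= u)%N) (e : (k + t)%N = u) (x : iter_ext t) :
  lift_ext tu x = cast_ext e (embed k x).
Proof.
have ek : k = (u - t)%N by rewrite -e addnK.
move: e; rewrite ek => e; rewrite /lift_ext.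
by rewrite (eq_irrelevance e (subnK tu)).
Qed.

Lemma embed_add j k t (x : iter_ext t) :
  embed j (embed k x) = cast_ext (esym (addnA j k t)) (embed (j + k) x).
Proof.
elim: j => [|j IH] /=; first by rewrite (eq_irrelevance (esym _) erefl).
rewrite IH; move: (esym (addnA j k t)) (esym (addnA j.+1 k t)) => e1.
move: (embed (j + k) x) => z e2 /=.
suff H : forall m1 m2 (e1 : m1 = m2) (e2 : m1.+1 = m2.+1) (z : iter_ext m1),
    old (n + m2) (cast_ext e1 z) = cast_ext e2 (old (n + m1) z : iter_ext m1.+1)
  by exact: H.
move=> m1 m2 {}e1; case: m2 / e1 => {}e2 {}z /=.
by rewrite (eq_irrelevance e2 erefl).
Qed.

Lemma lift_lift t u w (tu : (t <= u)%N) (uw : (u <= w)%N) (tw : (t <= w)%N)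
    (x : iter_ext t) : lift_ext uw (lift_ext tu x) = lift_ext tw x.
Proof.
have e : ((u - t) + t)%N = u by rewrite subnK.
have e' : ((w - u) + u)%N = w by rewrite subnK.
move: (u - t)%N (w - u)%N e e' => k j e e'.
rewrite (lift_embed tu e) (lift_embed uw e').
case: u / e e' {tu uw} => e' /=; case: w / e' tw => tw.
by rewrite embed_add (lift_embed tw (esym (addnA j k t))).
Qed.

Lemma lim_leE m (a b : lim_carrier) (am : (lim_rk a <= m)%N)
    (bm : (lim_rk b <= m)%N) :
  lim_le a b = (lift_ext am (lim_elt a) <= lift_ext bm (lim_elt b))%O.
Proof.
have mm : (maxn (lim_rk a) (lim_rk b) <= m)%N by rewrite geq_max am bm.
by rewrite /lim_le -(le_lift mm) !(lift_lift _ mm am) (lift_lift _ mm bm).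
Qed.

Lemma lim_le_refl : reflexive lim_le.
Proof. by move=> a; rewrite (lim_leE (leqnn _) (leqnn _)). Qed.

Lemma lim_le_anti : antisymmetric lim_le.
Proof.
move=> [i x xi] [j y yj] /andP[].
have im := leq_maxl i j; have jm := leq_maxr i j.
rewrite (@lim_leE (maxn i j) (Lim xi) (Lim yj) im jm).
rewrite (@lim_leE (maxn i j) (Lim yj) (Lim xi) jm im) /= => xy yx.
have exy : lift_ext im x = lift_ext jm y by apply/le_anti/andP.
have eij : i = j by rewrite -xi -yj -(rk_lift im x) exy rk_lift.
subst j; move: exy; rewrite (eq_irrelevance im jm) => exy.
have exy' : x = y by apply: le_anti; rewrite -!(le_lift jm) exy lexx.
by subst y; rewrite (eq_irrelevance xi yj).
Qed.

Lemma lim_le_trans : transitive lim_le.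
Proof.
move=> b a e; pose m := (lim_rk a + lim_rk b + lim_rk e)%N.
have am : (lim_rk a <= m)%N by rewrite /m -addnA leq_addr.
have bm : (lim_rk b <= m)%N by rewrite /m addnAC leq_addl.
have em : (lim_rk e <= m)%N by rewrite /m leq_addl.
rewrite (lim_leE am bm) (lim_leE bm em) (lim_leE am em); exact: le_trans.
Qed.

HB.instance Definition _ := Order.Le_isPOrder.Build d lim_carrier
  lim_le_refl lim_le_anti lim_le_trans.

Definition refl_lim : sposet d :=
  @SPoset d lim_carrier lim_rk lim_bot lim_sgn lim_vsgn erefl.

End Limit.

(* Main.v *)
Require Import Defs.
From mathcomp Require Import all_boot all_order all_algebra.
From mathcomp Require Import boolp classical_sets functions cardinality fsbigop.
From mathcomp Require Import ring.

Set Implicit Arguments.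
Unset Strict Implicit.
Unset Printing Implicit Defensive.

Import Order.TTheory GRing.Theory Num.Theory.

(** Evaluated at a single element y, both [UD + DU = I] and the condition on
    [U + D] (or [D - U]) are statements about y and the elements at most two
    covers away from it.  So being c-signed differential up to level
    n - 1 means that these two conditions hold at every y of rank below n
    ([signed_differential_uptoP]), and being c-signed differential means that
    they hold everywhere.

    This locality lets the conditions be carried along an embedding of P onto
    the elements of rank at most N of another poset Q: at an element of rank
    below N nothing above rank N is seen ([differential_at_emb]).  It is used
    for P inside [P^+], where only the rank n remains to be examined, and for
    each [P^{+t}] inside the limit, where every element has rank below n + t
    as soon as t is large.

    The rank n is where reflection acts.  Let y have rank n, and let e be -1
    in type alpha and 1 in type beta.  The elements covering y are [y^*],
    which contributes f(y) to (DUf)(y), and the [x^+] for the x covered by y.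
    The sign of [y < x^+] makes (Uf)([x^+]) equal to -e times (Df)(x), and the
    coefficient with which [x^+] enters D at y equal to e s(x < y).  As
    e^2 = 1, the elements [x^+] together contribute -(UDf)(y), whence
    UD + DU = I.  On the sum of all elements, with S the sum of the s(x < y),
    U gives S and D gives 1 + e S, so that U + D gives 1 when e = -1, and
    D - U gives 1 when e = 1 ([differential_at_top]).

    As for minima, the bottom of P lies below every old element and every
    [y^*], and lies below [x^+] exactly when some y covers x.  Beyond the
    first step this holds by itself, since each element of the top rank of
    [P^{+t}] is covered in [P^{+(t+1)}] by its own
    star ([star_covered]); so the limit has a minimum exactly when [P^+] has
    one. *)

(** * Pointwise form of the differential conditions *)

Section Pointwise.
Local Open Scope classical_set_scope.
Local Open Scope ring_scope.

Variables (K : fieldType) (d : Order.disp_t).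
Implicit Types P : sposet d.

Lemma is_signM (a b : int) : is_sign a -> is_sign b -> is_sign (a * b).
Proof.
by case=> -> [->|->]; rewrite ?mulrN ?mulNr ?mulr1 ?opprK;
  [left|right|right|left].
Qed.

Lemma is_signN (a : int) : is_sign a -> is_sign (- a).
Proof. by case=> ->; rewrite ?opprK; [right|left]. Qed.

Lemma is_sign_sqr (a : int) : is_sign a -> a * a = 1.
Proof. by case=> ->. Qed.

Lemma finite_covers_below P (y : P) : graded_signed P ->
  finite_set [set x | covers x y].
Proof.
move=> gP; apply: sub_finite_set (graded_finite gP (rk y).-1) => x /= xy.
by rewrite (graded_covers gP xy).
Qed.

Lemma eq_opU P (f g : P -> K) (y : P) :
  (forall x, covers x y -> f x = g x) -> opU f y = opU g y.
Proof. by move=> fg; apply: eq_fsbigr => x; rewrite inE /= => /fg ->. Qed.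

Lemma eq_opD P (f g : P -> K) (y : P) :
  (forall x, covers y x -> f x = g x) -> opD f y = opD g y.
Proof. by move=> fg; apply: eq_fsbigr => x; rewrite inE /= => /fg ->. Qed.

Definition differential_at c P (y : P) : Prop :=
  (forall f : P -> K, opU (opD f) y + opD (opU f) y = f y) /\
  sd_op c (all_sum K P) y = 1.

(** Going up one cover and down another returns to the starting rank, so only
    the values of f there matter; this allows f to be truncated to a single
    rank, and thus to lie in the span on which [UD + DU = I] is assumed. *)
Lemma eq_opUD_opDU P (f g : P -> K) (y : P) : graded_signed P ->
  (forall x, rk x = rk y -> f x = g x) ->
  opU (opD f) y + opD (opU f) y = opU (opD g) y + opD (opU g) y.
Proof.
move=> gP fg; congr (_ + _).
  apply: eq_opU => x /(graded_covers gP) xy; apply: eq_opD => z.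
  by move=> /(graded_covers gP) xz; apply: fg; rewrite xz xy.
apply: eq_opD => x /(graded_covers gP) xy; apply: eq_opU => z.
by move=> /(graded_covers gP); rewrite xy => -[/esym]; exact: fg.
Qed.

Lemma sum_rank_sumE P n (y : P) :
  (\sum_(i < n) rank_sum K P i) y = (rk y < n)%:R.
Proof.
rewrite fct_sumE /rank_sum; case: ltnP => ny.
  rewrite (bigD1 (Ordinal ny)) //= eqxx big1 ?addr0 // => i.
  by rewrite -val_eqE /= eq_sym => /negPf ->.
by rewrite big1 // => i _; rewrite gtn_eqF // (leq_trans _ ny).
Qed.

Lemma signed_differential_uptoP c n P : signed_differential_upto K c n P <->
  [/\ graded_signed P, forall x : P, (rk x <= n)%N, vsgn (bot P) = 1
    & forall y : P, (rk y < n)%N -> differential_at c y].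
Proof.
split=> -[gP rn v1] => [UD sdn | dn]; split=> //.
- move=> y yn; split=> [f|].
    pose g x := if rk x == rk y then f x else 0.
    rewrite (@eq_opUD_opDU _ f g) // => [|x xy]; last by rewrite /g xy eqxx.
    have /UD/(congr1 (@^~ y)) : span_below n g.
      by move=> x nx; rewrite /g gtn_eqF // (leq_trans yn).
    by rewrite /g eqxx.
  have yn' : rk y <> n by move=> e; rewrite e ltnn in yn.
  by have /eqP := sdn y yn'; rewrite !fctE sum_rank_sumE yn subr_eq0 => /eqP.
- move=> f fn; apply/funext => y; rewrite !fctE.
  (* at rank n both sides vanish, f being zero there *)
  have [/dn[]//|ny] := ltnP (rk y) n.
  rewrite (@eq_opUD_opDU _ f (fun=> 0)) // => [|x xy]; last first.
    by apply: fn; rewrite xy.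
  rewrite (fn _ ny) /opU /opD !fsbig1 ?addr0 // => x xy;
  by rewrite fsbig1 ?mulr0 // => z zx; rewrite mulr0.
- move=> y /eqP yn; have yn' : (rk y < n)%N by rewrite ltn_neqAle yn rn.
  by rewrite !fctE sum_rank_sumE yn' (dn _ yn').2 subrr.
Qed.

End Pointwise.

(** * Initial embeddings *)

Section Embedding.
Local Open Scope classical_set_scope.
Local Open Scope ring_scope.

Variable d : Order.disp_t.

(** P is, up to isomorphism, the part of Q of rank at most N.  Keeping this as
    a property of a map, rather than an equality of posets, serves both for
    the constructor [old] and for the maps into the limit, which are obtained
    by choice. *)
Record initial_embedding (N : nat) (P Q : sposet d) (i : P -> Q) : Prop :=
  InitialEmbedding {
    emb_le : forall x y, (i x <= i y)%O = (x <= y)%O ;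
    emb_rk : forall x, rk (i x) = rk x ;
    emb_sgn : forall x y, sgn (i x) (i y) = sgn x y ;
    emb_vsgn : forall x, vsgn (i x) = vsgn x ;
    emb_bounded : forall x : P, (rk x <= N)%N ;
    emb_onto : forall q : Q, (rk q <= N)%N -> exists x, i x = q }.

Variables (N : nat) (P Q : sposet d) (i : P -> Q).
Hypothesis emb : initial_embedding N i.

Lemma emb_inj : injective i.
Proof. by move=> x y e; apply/le_anti; rewrite -!(emb_le emb) e lexx. Qed.

Lemma emb_lt x y : (i x < i y)%O = (x < y)%O.
Proof. by rewrite !lt_neqAle (emb_le emb) (inj_eq emb_inj). Qed.

Hypothesis gltQ : forall a b : Q, (a < b)%O -> (rk a < rk b)%N.

(** The image is a down-set, since the order of Q increases the rank. *)
Lemma emb_below q y : (q < i y)%O -> exists x, i x = q.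
Proof.
move=> qy; apply: (emb_onto emb); apply: leq_trans (emb_bounded emb y).
by rewrite -(emb_rk emb) ltnW // gltQ.
Qed.

Lemma emb_covers x y : covers (i x) (i y) <-> covers x y.
Proof.
split=> -[xy nxy]; split; rewrite ?emb_lt // -?emb_lt // => z.
  by rewrite -!emb_lt; exact: nxy.
move=> /andP[xz zy]; have [w e] := emb_below zy.
by apply: (nxy w); rewrite -!emb_lt e xz.
Qed.

Variable K : fieldType.

Lemma opU_emb (f : Q -> K) y : opU f (i y) = opU (f \o i) y.
Proof.
rewrite /opU (reindex_fsbig i [set x | covers x y]) /=.
  by apply: eq_fsbigr => x _; rewrite (emb_sgn emb).
split=> [x /= /emb_covers|x z _ _ /emb_inj //|q /= qy]; first exact.
by have [x e] := emb_below qy.1; exists x => //; apply/emb_covers; rewrite e.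
Qed.

Hypothesis gcovQ : forall a b : Q, covers a b -> rk b = (rk a).+1.

(** Unlike [opU_emb], this fails at rank N, where an element may have new
    covers in Q. *)
Lemma opD_emb (f : Q -> K) y : (rk y < N)%N -> opD f (i y) = opD (f \o i) y.
Proof.
move=> yN; rewrite /opD (reindex_fsbig i [set x | covers y x]) /=.
  by apply: eq_fsbigr => x _; rewrite (emb_sgn emb) !(emb_vsgn emb).
split=> [x /= /emb_covers|x z _ _ /emb_inj //|q /= yq]; first exact.
have [|x e] := emb_onto emb (q := q); first by rewrite (gcovQ yq) (emb_rk emb).
by exists x => //; apply/emb_covers; rewrite e.
Qed.

(** At rank N this still holds: U only brings in elements of rank below N. *)
Lemma opUD_emb (f : Q -> K) y : opU (opD f) (i y) = opU (opD (f \o i)) y.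
Proof.
rewrite opU_emb; apply: eq_opU => x xy /=; apply: opD_emb.
have [lt_xy _] := xy.
apply: leq_trans (emb_bounded emb y).
by rewrite -!(emb_rk emb) gltQ // emb_lt.
Qed.

Lemma differential_at_emb c y : (rk y < N)%N ->
  differential_at K c y -> differential_at K c (i y).
Proof.
move=> yN [UD sd1]; split=> [f|].
  rewrite opUD_emb opD_emb // -[RHS](UD (f \o i)); congr (_ + _).
  by apply: eq_opD => x _; exact: opU_emb.
have U1 := opU_emb (all_sum K Q) y; have D1 := opD_emb (all_sum K Q) yN.
by rewrite -sd1 /sd_op; case: (c); rewrite !fctE U1 D1.
Qed.

End Embedding.

(** * Order and grading of the reflection extension *)

Section Extension.
Local Open Scope classical_set_scope.
Local Open Scope ring_scope.

Variables (d : Order.disp_t) (c : sd_type) (n : nat) (P : sposet d).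
Local Notation Pp := (refl_ext c n P).

Lemma old_emb : (forall x : P, (rk x <= n)%N) ->
  initial_embedding n (@old d n P : P -> Pp).
Proof.
by move=> rn; split=> // -[x|y ry|x rx]; [exists x|rewrite /= ltnn..].
Qed.

Lemma le_old_plus (z x : P) (rx : (rk x).+1 = n) :
  reflect (exists y : P, [/\ rk y = n, covers x y & (z <= y)%O])
    ((old n z : Pp) <= plus rx)%O.
Proof. exact: asboolP. Qed.

Lemma ext_minP : graded_signed P -> has_minimum P ->
  has_minimum Pp <-> (forall x : P, (rk x).+1 = n -> exists y : P, covers x y).
Proof.
move=> gP minP; split=> [minPp x rx|cov].
  by have /le_old_plus[y [_ xy _]] := minPp (plus rx); exists y.
case=> [x|y ry|x rx]; [exact: minP|exact: minP|].
have [y xy] := cov x rx; apply/le_old_plus; exists y; split=> //.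
by rewrite (graded_covers gP xy) rx.
Qed.

Hypotheses (gP : graded_signed P) (rn : forall x : P, (rk x <= n)%N).

Lemma ext_lt (a b : Pp) : (a < b)%O -> (rk a < rk b)%N.
Proof.
case: a b => [x|x rx|x rx] [y|y ry|y ry]; rewrite lt_neqAle => /andP[ab];
  rewrite /Order.le /=; rewrite ?ltnS ?rn // => le_ab.
- by apply: (graded_lt gP); rewrite lt_neqAle le_ab (contraNneq _ ab) // => ->.
- case/eqP: ab; move: le_ab => /eqP xy; subst y; congr star.
  exact: eq_irrelevance.
- case/eqP: ab; move: le_ab => /eqP xy; subst y; congr plus.
  exact: eq_irrelevance.
Qed.

Lemma old_lt (x y : P) : ((old n x : Pp) < old n y)%O = (x < y)%O.
Proof. exact: emb_lt (old_emb rn) x y. Qed.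

Lemma covers_old (x y : P) : covers (old n x : Pp) (old n y) <-> covers x y.
Proof. exact: emb_covers (old_emb rn) ext_lt x y. Qed.

Lemma old_neq_new (y : P) (b : Pp) : rk b = n.+1 -> (old n y : Pp) != b.
Proof.
by move=> rb; apply: contra_eq_neq rb => <- /=; rewrite ltn_eqF // ltnS.
Qed.

(** No y' other than y can sit just below [y^*], for [y' < y^*] means
    [y' <= y], and [y < y^*]. *)
Lemma covers_star (a : Pp) (y : P) (ry : rk y = n) :
  covers a (star ry : Pp) <-> a = old n y.
Proof.
split=> [[lt_ay na]|->].
  case: a lt_ay na => [x|x rx|x rx] lt_ay na;
    try by have := ext_lt lt_ay; rewrite /= ltnn.
  congr old; apply/eqP; have le_xy : (x <= y)%O by exact: ltW lt_ay.
  apply/negPn/negP => xy; apply: (na (old n y)).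
  rewrite old_lt lt_neqAle xy le_xy /=.
  by rewrite lt_neqAle old_neq_new //= [(_ <= _)%O]lexx.
split=> [|z /andP[/ext_lt yz /ext_lt /(leq_ltn_trans yz)]]; last first.
  by rewrite /= ltnS ry ltnn.
by rewrite lt_neqAle old_neq_new //= [(_ <= _)%O]lexx.
Qed.

Lemma covers_plus (a : Pp) (x : P) (rx : (rk x).+1 = n) :
  covers a (plus rx : Pp) <-> exists2 y, a = old n y & covers x y.
Proof.
have lt_plus y : rk y = n -> covers x y -> ((old n y : Pp) < plus rx)%O.
  move=> ry xy; rewrite lt_neqAle old_neq_new //=; apply/le_old_plus.
  by exists y; split.
split=> [[lt_ax na]|[y -> xy]].
  case: a lt_ax na => [z|z rz|z rz] lt_ax na;
    try by have := ext_lt lt_ax; rewrite /= ltnn.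
  have /ltW/le_old_plus[y [ry xy zy]] := lt_ax.
  exists z => //; suff -> : z = y by [].
  apply/eqP/negPn/negP => nzy; apply: (na (old n y)).
  by rewrite old_lt lt_neqAle nzy zy lt_plus.
have ry : rk y = n by rewrite (graded_covers gP xy).
split=> [|z /andP[/ext_lt yz /ext_lt /(leq_ltn_trans yz)]].
  exact: lt_plus.
by rewrite /= ltnS ry ltnn.
Qed.

Lemma ext_graded : graded_signed Pp.
Proof.
have sv := vsgn_sign gP.
split.
- exact: ext_lt.
- move=> a [y|y ry|x rx] ab.
  + case: a ab => [x /covers_old|x rx|x rx]; first exact: graded_covers gP _ _;
    by case=> /ltW.
  + by move: ab => /covers_star -> /=; rewrite ry.
  + by move: ab => /covers_plus[y -> /(graded_covers gP) /= ->]; rewrite rx.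
- (* each x of P gives rise to at most three elements of the extension *)
  move=> i; pose newT (x : P) : set Pp :=
    [set a | [\/ a = old n x, exists rx, a = @star _ n P x rx
               | exists rx, a = @plus _ n P x rx]].
  pose PT := \bigcup_(j in `I_n.+1) [set x : P | rk x = j].
  apply: (@sub_finite_set _ _ (\bigcup_(x in PT) newT x)).
    move=> [x|x rx|x rx] _; exists x => //.
    + by exists (rk x) => //=; rewrite ltnS.
    + by constructor 1.
    + by exists (rk x) => //=; rewrite ltnS.
    + by constructor 2; exists rx.
    + by exists (rk x) => //=; rewrite ltnS.
    + by constructor 3; exists rx.
  apply: bigcup_finite => [|x _].
    by apply: bigcup_finite => // j _; exact: (graded_finite gP).
  pose s : set Pp := [set a | exists rx, a = @star _ n P x rx].
  pose p : set Pp := [set a | exists rx, a = @plus _ n P x rx].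
  apply: (@sub_finite_set _ _ ([set old n x] `|` (s `|` p))).
    by move=> a [?|?|?]; [left|right; left|right; right].
  have sub1 (A : set Pp) : (forall a b, A a -> A b -> a = b) -> finite_set A.
    move=> A1; have [[a Aa]|nA] := pselect (exists a, A a).
      by apply: (@sub_finite_set _ _ [set a]) => // b /A1; exact.
    by apply: (@sub_finite_set _ _ set0) => // a Aa; apply: nA; exists a.
  rewrite !finite_setU; split; [exact: finite_set1|split]; apply: sub1.
    by move=> _ _ [r ->] [r' ->]; congr star; exact: eq_irrelevance.
  by move=> _ _ [r ->] [r' ->]; congr plus; exact: eq_irrelevance.
- move=> [x|x rx|x rx] [y|y ry|y ry] ab /=; try by left.
  + by apply: (sgn_sign gP); apply/covers_old.
  + apply: is_signM; first by rewrite /type_sign; case: (c); [right|left].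
    apply: is_signM; first by apply: is_signM; [apply: is_signN|].
    move: ab => /covers_plus[_ [<-] yx]; exact: sgn_sign gP _ _ yx.
- by move=> [x|x _|x _] /=; [| |apply: is_signN].
Qed.

End Extension.

(* The type c cannot be inferred from elements of [ext_carrier n P]. *)
Arguments covers_star {d} c {n P} gP rn {a y ry}.
Arguments covers_plus {d} c {n P} gP rn {a x rx}.
Arguments covers_old {d} c {n P} gP rn {x y}.

(** * The former top rank *)

Section TopRank.
Local Open Scope classical_set_scope.
Local Open Scope ring_scope.

Variables (K : fieldType) (d : Order.disp_t) (c : sd_type) (n : nat).
Variable P : sposet d.
Hypotheses (gP : graded_signed P) (rn : forall x : P, (rk x <= n)%N).
Local Notation Pp := (refl_ext c n P).

(** The constructor [plus] takes a proof that x has rank n - 1; the value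
    [old n x] at other ranks makes it a total function, over which a sum
    indexed by elements of P can be written. *)
Definition plus_or_old (x : P) : Pp :=
  if (rk x).+1 =P n is ReflectT rx then plus rx else old n x.

Lemma plus_or_oldE (x : P) (rx : (rk x).+1 = n) : plus_or_old x = plus rx.
Proof.
rewrite /plus_or_old; case: eqP => // rx'; congr plus; exact: eq_irrelevance.
Qed.

Lemma opU_star (f : Pp -> K) (y : P) (ry : rk y = n) :
  opU f (star ry : Pp) = f (old n y).
Proof.
rewrite /opU (_ : [set a | _] = [set (old n y : Pp)]); last first.
  by apply/seteqP; split=> a /= /(covers_star c gP rn).
by rewrite fsbig_set1 mul1r.
Qed.

(** The elements covered by [x^+] are those covering x, so U at [x^+] sums over
    the same elements as D at x; the minus sign is that of
    [v^+(x^+) = - v(x)]. *)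
Lemma opU_plus (f : Pp -> K) (x : P) (rx : (rk x).+1 = n) :
  opU f (plus rx : Pp) = - (type_sign c)%:~R * opD (f \o @old d n P) x.
Proof.
rewrite /opU /opD mulr_fsumr.
rewrite (reindex_fsbig (@old d n P : P -> Pp) [set y | covers x y]) /=.
  by apply: eq_fsbigr => y _ /=; rewrite !(rmorphM, rmorphN) /=; ring.
split=> [y /= xy|y z _ _ [] //|a /= /(covers_plus c gP rn)[y -> xy]].
  by apply/(covers_plus c gP rn); exists y.
by exists y.
Qed.

(** In the coefficient of [x^+], the product of [s^+], [v^+(x^+)] and [v(y)]
    contains the squares of [v(x)] and [v(y)], and only the type and s(x, y)
    remain. *)
Lemma opD_top (g : Pp -> K) (y : P) (ry : rk y = n) :
  opD g (old n y) = g (star ry) +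
    (type_sign c)%:~R *
      \sum_(x \in [set x | covers x y]) (sgn x y)%:~R * g (plus_or_old x).
Proof.
have rk_below x : covers x y -> (rk x).+1 = n by move/(graded_covers gP) => <-.
have v2 (x : P) : ((vsgn x)%:~R * (vsgn x)%:~R : K) = 1.
  by rewrite -intrM (is_sign_sqr (vsgn_sign gP x)).
rewrite /opD (_ : [set b | _] = [set (star ry : Pp)] `|`
    plus_or_old @` [set x | covers x y]); last first.
  apply/seteqP; split=> [[z|z rz|z rz] /= yz|b /=].
  - move: yz => /(covers_old c gP rn)/(graded_covers gP) e.
    by have := rn z; rewrite e ry ltnn.
  - left; move: yz => /(covers_star c gP rn)[e]; subst z; congr star.
    exact: eq_irrelevance.
  - right; move: yz => /(covers_plus c gP rn)[_ [<-] zy].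
    by exists z => //; rewrite plus_or_oldE.
  - case=> [->|[x xy <-]]; first exact/(covers_star c gP rn).
    rewrite (plus_or_oldE (rk_below x xy)); apply/(covers_plus c gP rn).
    by exists y.
rewrite fsbigU; first last.
- move=> b /= [-> [x /rk_below rx]]; by rewrite (plus_or_oldE rx).
- exact/finite_image/finite_covers_below.
- exact: finite_set1.
rewrite fsbig_set1 /= mul1r rmorphM v2 mul1r; congr (_ + _).
rewrite mulr_fsumr fsbig_image; last first.
  move=> x z; rewrite !inE => /rk_below rx /rk_below rz.
  by rewrite (plus_or_oldE rx) (plus_or_oldE rz) => -[].
apply: eq_fsbigr => x; rewrite inE /= => /rk_below rx.
rewrite (plus_or_oldE rx) /= !(rmorphM, rmorphN) /=.
transitivity ((type_sign c)%:~R * ((vsgn x)%:~R * (vsgn x)%:~R) *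
  ((vsgn y)%:~R * (vsgn y)%:~R) * (sgn x y)%:~R * g (plus rx)); first ring.
by rewrite !v2 !mulr1 mulrA.
Qed.

Lemma type_sign_sqr : ((type_sign c)%:~R * (type_sign c)%:~R : K) = 1.
Proof. by rewrite -intrM; case: (c). Qed.

(** The choice of [s^+] is made for this: the contribution of the [x^+] to
    [DU] is the opposite of [UD], and that of [y^*] is the identity. *)
Lemma differential_at_top (y : P) :
  rk y = n -> differential_at K c (old n y : Pp).
Proof.
move=> ry; have emb := old_emb c rn.
have gPp := ext_graded c gP rn.
have rk_below x : covers x y -> (rk x).+1 = n by move/(graded_covers gP) => <-.
split=> [f|].
  rewrite (opUD_emb emb (ext_lt gP rn) (graded_covers gPp)) (opD_top _ ry).
  rewrite opU_star [X in _ + X]addrC addrA [X in X + _](_ : _ = 0) ?add0r //.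
  rewrite /opU mulr_fsumr -fsbig_split /=; last exact: finite_covers_below.
  apply: fsbig1 => x /= xy.
  rewrite (plus_or_oldE (rk_below x xy)) -/(opU f _) opU_plus.
  set D := opD _ _; set e := (type_sign c)%:~R; set s := (sgn x y)%:~R.
  transitivity (s * D - (e * e) * (s * D)); first ring.
  by rewrite /e type_sign_sqr mul1r subrr.
pose S : K := \sum_(x \in [set x | covers x y]) (sgn x y)%:~R * (1 : K).
have U1 : opU (all_sum K Pp) (old n y) = S := opU_emb emb (ext_lt gP rn) _ y.
have D1 : opD (all_sum K Pp) (old n y) = 1 + (type_sign c)%:~R * S.
  exact: opD_top.
transitivity (if c is alpha then S + (1 + (type_sign c)%:~R * S)
              else 1 + (type_sign c)%:~R * S - S).
  by rewrite -D1 -U1; case: (c).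
by rewrite /type_sign; case: (c); ring.
Qed.

End TopRank.

(** * Iterated extensions *)

Section ExtensionTheorem.
Variables (K : fieldType) (d : Order.disp_t) (c : sd_type).

Lemma refl_ext_upto n (P : sposet d) :
  signed_differential_upto K c n P ->
  signed_differential_upto K c n.+1 (refl_ext c n P).
Proof.
move=> /signed_differential_uptoP[gP rn v1 dP]; have gPp := ext_graded c gP rn.
apply/signed_differential_uptoP; split=> //.
  by case=> [x|y ry|x rx] //=; rewrite leqW.
case=> [y|y ry|x rx]; rewrite /= ?ltnn // ltnS leq_eqVlt => /orP[/eqP|] yn.
  exact: differential_at_top.
exact: (differential_at_emb (old_emb c rn) (graded_lt gPp) (graded_covers gPp)
  yn (dP y yn)).
Qed.

Lemma iter_ext_upto n (P : sposet d) t :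
  signed_differential_upto K c n P ->
  signed_differential_upto K c (n + t) (iter_ext c n P t).
Proof.
by move=> dP; elim: t => [|t IH]; rewrite ?addn0 // addnS; exact: refl_ext_upto.
Qed.

End ExtensionTheorem.

(** * The limit as an increasing union *)

Section LimitTheorem.
Local Open Scope classical_set_scope.
Local Open Scope ring_scope.

Variables (d : Order.disp_t) (c : sd_type) (n : nat) (P : sposet d).
Local Notation Pt := (iter_ext c n P).
Local Notation L := (refl_lim c n P).

Lemma sgn_lift t u (tu : (t <= u)%N) (x y : Pt t) :
  sgn (lift_ext tu x) (lift_ext tu y) = sgn x y.
Proof.
have sgn_cast v w (e : v = w) (a b : Pt v) :
  sgn (cast_ext e a) (cast_ext e b) = sgn a b by case: w / e.
by rewrite sgn_cast; elim: (u - t)%N => //= k <-.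
Qed.

Lemma vsgn_lift t u (tu : (t <= u)%N) (x : Pt t) :
  vsgn (lift_ext tu x) = vsgn x.
Proof.
have vsgn_cast v w (e : v = w) (a : Pt v) : vsgn (cast_ext e a) = vsgn a.
  by case: w / e.
by rewrite vsgn_cast; elim: (u - t)%N => //= k <-.
Qed.

Lemma bot_lift t u (tu : (t <= u)%N) : lift_ext tu (bot (Pt t)) = bot (Pt u).
Proof.
have bot_cast v w (e : v = w) : cast_ext e (bot (Pt v)) = bot (Pt w).
  by case: w / e.
rewrite /lift_ext (_ : embed _ _ = bot (Pt (u - t + t))) ?bot_cast //.
by elim: (u - t)%N => //= k ->.
Qed.

Lemma lift_succ t (x : Pt t) : lift_ext (leqnSn t) x = old (n + t) x :> Pt t.+1.
Proof. exact: (@Defs.lift_embed _ c n P 1 t t.+1 (leqnSn t) erefl x). Qed.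

Lemma lift_id t (tt : (t <= t)%N) (x : Pt t) : lift_ext tt x = x.
Proof. exact: (@Defs.lift_embed _ c n P 0 t t tt erefl x). Qed.

Lemma lift_inj t u (tu : (t <= u)%N) : injective (@lift_ext _ c n P t u tu).
Proof. by move=> x y e; apply/le_anti; rewrite -!(le_lift tu) e lexx. Qed.

Lemma lim_sgnE m (a b : L) (am : (lim_rk a <= m)%N) (bm : (lim_rk b <= m)%N) :
  sgn a b = sgn (lift_ext am (lim_elt a)) (lift_ext bm (lim_elt b)).
Proof.
have mm : (maxn (lim_rk a) (lim_rk b) <= m)%N by rewrite geq_max am bm.
rewrite /= /lim_sgn -(sgn_lift mm).
by rewrite (lift_lift _ mm am) (lift_lift _ mm bm).
Qed.

(** Elements of the limit of rank r are coded in [iter_ext c n P r], whereas an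
    element of [iter_ext c n P t] can have any rank up to n + t, smaller or
    larger than t.  Equality of the lifts to a common index tells when the two
    stand for the same element of the union. *)
Definition represents t (x : Pt t) (a : L) : Prop :=
  exists m (tm : (t <= m)%N) (am : (lim_rk a <= m)%N),
    lift_ext am (lim_elt a) = lift_ext tm x.

Lemma representsP t (x : Pt t) (a : L) m (tm : (t <= m)%N)
    (am : (lim_rk a <= m)%N) :
  represents x a -> lift_ext am (lim_elt a) = lift_ext tm x.
Proof.
move=> [m' [tm' [am']]].
have mM := leq_maxl m m'; have m'M := leq_maxr m m'.
move=> /(congr1 (lift_ext m'M)) e; apply: (@lift_inj _ _ mM).
move: e; rewrite !(lift_lift _ _ (leq_trans am mM)).
by rewrite !(lift_lift _ _ (leq_trans tm mM)).
Qed.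

Lemma represents_rk t (x : Pt t) (a : L) : represents x a -> rk a = rk x.
Proof.
move=> [m [tm [am /(congr1 rk)]]]; rewrite !rk_lift => <-.
by rewrite lim_eltP.
Qed.

Lemma represents_old t (x : Pt t) (a : L) :
  represents x a -> represents (old (n + t) x : Pt t.+1) a.
Proof.
move=> xa; rewrite -lift_succ; pose m := (t.+1 + rk a)%N.
have tm : (t < m)%N by exact: leq_addr.
exists m, tm, (leq_addl _ _); rewrite (lift_lift _ _ (ltnW tm)).
exact: representsP.
Qed.

(** If the rank of x is at least t, the code of x is its lift to that index;
    otherwise x is an old element, and descends to a smaller index. *)
Lemma represents_ex t (x : Pt t) : exists a : L, represents x a.
Proof.
have top u (y : Pt u) : (u <= rk y)%N -> exists a : L, represents y a.
  move=> uy; have ry : rk (lift_ext uy y) = rk y by rewrite rk_lift.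
  by exists (Lim ry), (rk y), uy, (leqnn _); rewrite lift_id.
elim: t x => [|t IH] x; first exact: top.
have [|] := leqP t.+1 (rk x); first exact: top.
case: x => [x|x rx|x rx] /= xt; last 2 first.
- by move: xt; rewrite !ltnS ltnNge leq_addl.
- by move: xt; rewrite !ltnS ltnNge leq_addl.
by have [a xa] := IH x; exists a; exact: represents_old.
Qed.

Lemma iter_ext_old t (x : Pt t.+1) : (rk x <= n + t)%N ->
  exists y : Pt t, x = old (n + t) y.
Proof. by case: x => [y|y ry|y ry] /=; rewrite ?ltnn //; exists y. Qed.

(** The extensions after step t only add elements of rank above n + t. *)
Lemma lift_onto t u (tu : (t <= u)%N) (x : Pt u) : (rk x <= n + t)%N ->
  exists y : Pt t, lift_ext tu y = x.
Proof.
elim: u tu x => [|u IH] tu x xt.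
  have t0 : t = 0%N by apply/eqP; rewrite -leqn0.
  by subst t; exists x; rewrite lift_id.
have [e|tu'] : t = u.+1 \/ (t <= u)%N.
  by have := tu; rewrite leq_eqVlt => /orP[/eqP|]; [left|right].
  by subst t; exists x; rewrite lift_id.
have [z e] : exists z : Pt u, x = old (n + u) z.
  by apply: iter_ext_old; rewrite (leq_trans xt) // leq_add2l.
subst x; have [y <-] := IH tu' z xt.
by exists y; rewrite -lift_succ lift_lift.
Qed.

Hypothesis bounded : forall t (x : Pt t), (rk x <= n + t)%N.

(** The relation [represents] is turned into a map by choice; this map reaches
    every a of rank at most n + t, since by antisymmetry of the order of the
    limit no x represents two elements. *)
Lemma lim_emb t : exists i : Pt t -> L,
  initial_embedding (n + t) i /\ forall x, represents x (i x).
Proof.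
have [i ix] := choice (@represents_ex t); exists i; split=> //.
have rki x := represents_rk (ix x).
split=> //.
- move=> x y; pose m := (t + (rk (i x) + rk (i y)))%N.
  have tm : (t <= m)%N by exact: leq_addr.
  have xm : (lim_rk (i x) <= m)%N by rewrite /m addnCA leq_addr.
  have ym : (lim_rk (i y) <= m)%N by rewrite /m addnA leq_addl.
  rewrite [LHS](lim_leE xm ym).
  by rewrite (representsP tm xm (ix x)) (representsP tm ym (ix y)) le_lift.
- move=> x y; pose m := (t + (rk (i x) + rk (i y)))%N.
  have tm : (t <= m)%N by exact: leq_addr.
  have xm : (lim_rk (i x) <= m)%N by rewrite /m addnCA leq_addr.
  have ym : (lim_rk (i y) <= m)%N by rewrite /m addnA leq_addl.
  rewrite (lim_sgnE xm ym).
  by rewrite (representsP tm xm (ix x)) (representsP tm ym (ix y)) sgn_lift.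
- move=> x; have [m [tm [xm e]]] := ix x.
  by rewrite /= /lim_vsgn -(vsgn_lift xm) e vsgn_lift.
- move=> a ra; have ta := leq_addr (rk a) t; have at_ := leq_addl t (rk a).
  have [|x e] := lift_onto ta (x := lift_ext at_ (lim_elt a)).
    by rewrite rk_lift lim_eltP.
  exists x; apply/le_anti.
  have xm : (lim_rk (i x) <= t + rk a)%N.
    by rewrite [lim_rk _](rki x) -(rk_lift ta) e rk_lift lim_eltP leq_addl.
  have E : lift_ext xm (lim_elt (i x)) = lift_ext at_ (lim_elt a).
    by rewrite (representsP ta xm (ix x)).
  by rewrite [X in X && _](lim_leE xm at_) [X in _ && X](lim_leE at_ xm) E lexx.
Qed.

Hypothesis graded : forall t, graded_signed (Pt t).

(** Finitely many elements of the limit lie in the image of a single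
    [iter_ext c n P t], which is graded. *)
Lemma lim_graded : graded_signed L.
Proof.
have lt_rk (a b : L) : (a < b)%O -> (rk a < rk b)%N.
  have [i [emb _]] := lim_emb (rk a + rk b).
  have [|x <-] := emb_onto emb (q := a); first by rewrite addnCA leq_addr.
  have [|y <-] := emb_onto emb (q := b); first by rewrite addnA leq_addl.
  by rewrite (emb_lt emb) !(emb_rk emb); exact: graded_lt.
have cov2 (a b : L) : covers a b -> exists t (i : Pt t -> L) x y,
    [/\ initial_embedding (n + t) i, a = i x, b = i y & covers x y].
  have [i [emb _]] := lim_emb (rk a + rk b).
  have [|x <-] := emb_onto emb (q := a); first by rewrite addnCA leq_addr.
  have [|y <-] := emb_onto emb (q := b); first by rewrite addnA leq_addl.
  by move=> /(emb_covers emb lt_rk) xy; exists (rk a + rk b)%N, i, x, y.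
split=> //.
- move=> a b /cov2[t [i [x [y [emb -> -> xy]]]]].
  by rewrite !(emb_rk emb); exact: graded_covers xy.
- move=> r; have [i [emb _]] := lim_emb r.
  have := finite_image i (graded_finite (graded r) r).
  apply: sub_finite_set => a /= ar.
  have [|x e] := emb_onto emb (q := a); first by rewrite [rk a]ar leq_addl.
  by exists x => //=; rewrite -(emb_rk emb) e.
- move=> a b /cov2[t [i [x [y [emb -> -> xy]]]]].
  by rewrite (emb_sgn emb); exact: sgn_sign xy.
- by move=> a; exact: vsgn_sign (graded (lim_rk a)) (lim_elt a).
Qed.

End LimitTheorem.

(** For t = rank a + 1, the element a comes from one strictly below the top rank
    n + t of [iter_ext c n P t], where the differential conditions hold. *)
Lemma refl_lim_signed_differential (K : fieldType) d c n (P : sposet d) :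
  signed_differential_upto K c n P ->
  signed_differential K c (refl_lim c n P).
Proof.
move=> dP.
have dPt t := (signed_differential_uptoP _ _ _ _).1 (iter_ext_upto t dP).
have gL : graded_signed (refl_lim c n P).
  by apply: lim_graded => t; case: (dPt t).
have dL (a : refl_lim c n P) : differential_at K c a.
  have bd t (x : iter_ext c n P t) : (rk x <= n + t)%N by case: (dPt t).
  have [i [emb _]] := lim_emb bd (rk a).+1.
  have an : (rk a < n + (rk a).+1)%N by rewrite leq_addl.
  have [|x e] := emb_onto emb (q := a); first exact: ltnW.
  have xn : (rk x < n + (rk a).+1)%N by rewrite -(emb_rk emb) e.
  rewrite -e.
  apply: (differential_at_emb emb (graded_lt gL) (graded_covers gL)) => //.
  by have [_ _ _] := dPt (rk a).+1; exact.
split=> //.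
- by case: dP.
- by move=> f; apply/funext => a; exact: (dL a).1.
- by apply/funext => a; exact: (dL a).2.
Qed.

(** * Minima *)

Lemma star_covered d c n (P : sposet d) (gP : graded_signed P)
    (rn : forall x : P, (rk x <= n)%N) (x : refl_ext c n P) :
  rk x = n -> exists y : refl_ext c n P, covers x y.
Proof.
case: x => [x|x rx|x rx] /= rx'; try by have := n_Sn n; rewrite rx'.
by exists (star rx'); apply/(covers_star c gP rn).
Qed.

Section Minimum.
Variables (d : Order.disp_t) (c : sd_type) (n : nat) (P : sposet d).
Local Notation Pt := (iter_ext c n P).
Local Notation L := (refl_lim c n P).
Hypothesis bounded : forall t (x : Pt t), (rk x <= n + t)%N.
Hypothesis graded : forall t, graded_signed (Pt t).

(** After the first step the obstruction of [ext_minP] cannot occur, elements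
    one rank below the top being covered by their stars. *)
Lemma iter_ext_min t : has_minimum (refl_ext c n P) -> has_minimum (Pt t.+1).
Proof.
move=> min1; elim: t => [|t IH]; first by rewrite /= addn0.
apply/(@ext_minP d c (n + t.+1) _ (graded _) IH) => x rx.
apply: (star_covered (graded t) (bounded (t := t))).
by move: rx; rewrite addnS => -[].
Qed.

Lemma bot_lim_le (a : L) :
  (bot L <= a)%O = (bot (Pt (rk a).+1) <= lift_ext (leqnSn _) (lim_elt a))%O.
Proof.
rewrite [LHS](@lim_leE _ c n P _ (bot L) a (leq0n _) (leqnSn _)).
by rewrite (@bot_lift d c n P 0 _ (leq0n _)).
Qed.

Lemma iter_lim_min : (forall t, has_minimum (Pt t.+1)) -> has_minimum L.
Proof. by move=> minPt a; rewrite bot_lim_le; exact: minPt. Qed.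

Lemma lim_min_iter : has_minimum L -> has_minimum (Pt 1).
Proof.
move=> minL x; have [i [_ ix]] := lim_emb bounded 1.
have := minL (i x); rewrite bot_lim_le (representsP (ltn0Sn _) _ (ix x)).
by rewrite -(@bot_lift d c n P 1 _ (ltn0Sn _)) le_lift.
Qed.

End Minimum.

Theorem proposition4p4 (K : fieldType) (charK : [pchar K]%R =i pred0)
    (d : Order.disp_t) (c : sd_type) (n : nat) (P : sposet d)
    (minP : has_minimum P) (sdP : signed_differential_upto K c n P) :
  [/\ signed_differential_upto K c n.+1 (refl_ext c n P),
      signed_differential K c (refl_lim c n P)
    & let covered := forall x : P, (rk x).+1 = n -> exists y : P, covers x y in
      (has_minimum (refl_ext c n P) <-> covered) /\
      (has_minimum (refl_lim c n P) <-> covered)].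
Proof.
have dPt t := (signed_differential_uptoP _ _ _ _).1 (iter_ext_upto t sdP).
have graded t : graded_signed (iter_ext c n P t) by case: (dPt t).
have bounded t (x : iter_ext c n P t) : (rk x <= n + t)%N by case: (dPt t).
have min1 := @ext_minP d c n P (graded 0%N) minP.
split; [exact: refl_ext_upto|exact: refl_lim_signed_differential|].
split=> //; rewrite -min1; split=> [/(lim_min_iter bounded)|minPp].
  by rewrite /= addn0.
by apply: iter_lim_min => t; exact: iter_ext_min.
Qed.
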